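(* (1) Let $\mathscr{C}$ and $\mathscr{D}$ be monoidal categories, let $\mathscr{M}$ be a right $\mathscr{C}$-module category and $\mathscr{N}$ a right $\mathscr{D}$-module category, and let $F\colon\mathscr{C}\rightleftarrows\mathscr{D}\colon U$ be an oplax monoidal adjunction. For an (ordinary) adjunction $G\colon\mathscr{M}\rightleftarrows\mathscr{N}\colon V$, lifts of $G\dashv V$ to a comodule adjunction over $F\dashv U$ are in bijection with lifts of $V\colon\mathscr{N}\to\mathscr{M}$ to a strong comodule functor over $U$. (2) Let $\mathscr{C}$ be a monoidal category, let $\mathscr{M},\mathscr{N}$ be $\mathscr{C}$-module categories, and let $F\colon\mathscr{M}\rightleftarrows\mathscr{N}\colon U$ be an adjunction (with $F$ left adjoint). Then there is a bijection between oplax $\mathscr{C}$-module structures on $F$ and lax $\mathscr{C}$-module structures on $U$.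
   Context: Associators and unitors are suppressed. An oplax monoidal functor $(F,F_2,F_0)$ has coherent maps $F_{2;x,y}\colon F(x\otimes y)\to Fx\otimes Fy$, $F_0\colon F1\to1$. An oplax monoidal adjunction is an adjunction $F\dashv U$ between monoidal categories in which $F$ and $U$ are oplax monoidal and unit and counit are oplax monoidal transformations. Let $F\colon\mathscr{C}\to\mathscr{D}$ be oplax monoidal, $\mathscr{M}$ a right $\mathscr{C}$-module and $\mathscr{N}$ a right $\mathscr{D}$-module category (actions denoted $\triangleleft$). A (right) comodule functor over $F$ is a functor $G\colon\mathscr{M}\to\mathscr{N}$ with a natural transformation (coaction) $G_{\mathsf a;m,x}\colon G(m\triangleleft x)\to Gm\triangleleft Fx$ satisfying $(G_{\mathsf a;m,x}\triangleleft Fy)\circ G_{\mathsf a;m\triangleleft x,y}=(Gm\triangleleft F_{2;x,y})\circ G_{\mathsf a;m,x\otimes y}$ and $(Gm\triangleleft F_0)\circ G_{\mathsf a;m,1}=\mathrm{id}_{Gm}$. It is strong if $G_{\mathsf a}$ is invertible. Given an oplax monoidal adjunction $F\dashv U$ and an adjunction $G\dashv V$ where $G$ is a comodule functor over $F$ and $V$ one over $U$, this is a comodule adjunction if $V_{\mathsf a;Gm,Fx}\circ V(G_{\mathsf a;m,x})\circ\eta^{(G\dashv V)}_{m\triangleleft x}=\eta^{(G\dashv V)}_m\triangleleft\eta^{(F\dashv U)}_x$ and $(\varepsilon^{(G\dashv V)}_n\triangleleft\varepsilon^{(F\dashv U)}_y)\circ G_{\mathsf a;Vn,Uy}\circ G(V_{\mathsf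 a;n,y})=\varepsilon^{(G\dashv V)}_{n\triangleleft y}$ for all $m,n,x,y$. A lift of an adjunction $G\dashv V$ to a comodule adjunction is a choice of coactions on $G$ and $V$ making it one (with the given unit and counit); a lift of $V$ to a strong comodule functor is a choice of invertible coaction. An oplax (resp. lax) $\mathscr{C}$-module structure on a functor $F$ between left $\mathscr{C}$-module categories is a natural transformation $F(x\triangleright m)\to x\triangleright Fm$ (resp. $x\triangleright Fm\to F(x\triangleright m)$) satisfying the usual associativity and unitality conditions. *)

(* Defs.v *)
From mathcomp Require Import ssreflect ssrfun.

Set Implicit Arguments.
Unset Strict Implicit.
Unset Printing Implicit Defensive.

Declare Scope cat_scope.
Delimit Scope cat_scope with cat.
Local Open Scope cat_scope.

Reserved Notation "a ~> b" (at level 60, no associativity).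
Reserved Notation "g ∘ f" (at level 50, left associativity).
Reserved Notation "x ⊗ y" (at level 40, left associativity).
Reserved Notation "f ⊗₁ g" (at level 40, left associativity).
Reserved Notation "m ◁ x" (at level 40, left associativity).
Reserved Notation "f ◁₁ g" (at level 40, left associativity).
Reserved Notation "x ▷ m" (at level 40, left associativity).
Reserved Notation "f ▷₁ g" (at level 40, left associativity).

Record category := Category {
  obj :> Type;
  hom : obj -> obj -> Type;
  idm : forall a, hom a a;
  comp : forall a b c, hom b c -> hom a b -> hom a c;
  comp1m : forall a b (f : hom a b), comp (idm b) f = f;
  compm1 : forall a b (f : hom a b), comp f (idm a) = f;
  compA : forall a b c d (h : hom c d) (g : hom b c) (f : hom a b),
    comp h (comp g f) = comp (comp h g) f }.

Notation "a ~> b" := (hom a b) : cat_scope.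
Notation "g ∘ f" := (comp g f) : cat_scope.

Definition is_iso (C : category) (a b : C) (f : a ~> b) : Prop :=
  exists g : b ~> a, g ∘ f = idm a /\ f ∘ g = idm b.

Record functor (C D : category) := Functor {
  fobj :> C -> D;
  fmap : forall a b, a ~> b -> fobj a ~> fobj b;
  fmap1 : forall a, fmap (idm a) = idm (fobj a);
  fmapM : forall a b c (g : b ~> c) (f : a ~> b),
    fmap (g ∘ f) = fmap g ∘ fmap f }.

Arguments fmap {C D} F {a b} f : rename.

Definition idF (C : category) : functor C C :=
  @Functor C C (fun a => a) (fun _ _ f => f)
    (fun _ => erefl) (fun _ _ _ _ _ => erefl).

Section CompositeFunctor.
Variables (C D E : category) (G : functor D E) (F : functor C D).

Fact compF_map1 a : fmap G (fmap F (idm a)) = idm (G (F a)).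
Proof. by rewrite !fmap1. Qed.

Fact compF_mapM (a b c : C) (g : b ~> c) (f : a ~> b) :
  fmap G (fmap F (g ∘ f)) = fmap G (fmap F g) ∘ fmap G (fmap F f).
Proof. by rewrite !fmapM. Qed.

Definition compF : functor C E :=
  @Functor C E (fun a => G (F a)) (fun _ _ f => fmap G (fmap F f))
    compF_map1 compF_mapM.
End CompositeFunctor.

Record nat_trans (C D : category) (F G : functor C D) := NatTrans {
  ntc :> forall a, F a ~> G a;
  ntcN : forall a b (f : a ~> b), ntc b ∘ fmap F f = fmap G f ∘ ntc a }.

(* [adjunction F U] is the data of an adjunction with F left adjoint to U. *)
Record adjunction (C D : category) (F : functor C D) (U : functor D C) :=
  Adjunction {
  adj_unit : nat_trans (idF C) (compF U F);
  adj_counit : nat_trans (compF F U) (idF D);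
  adj_triangleL : forall x : C, adj_counit (F x) ∘ fmap F (adj_unit x) = idm (F x);
  adj_triangleR : forall y : D, fmap U (adj_counit y) ∘ adj_unit (U y) = idm (U y) }.

(* A functor of two variables A x B -> C, in curried form. *)
Record bifunctor (A B C : category) := Bifunctor {
  bobj :> A -> B -> C;
  bmap : forall a a' b b', a ~> a' -> b ~> b' -> bobj a b ~> bobj a' b';
  bmap1 : forall a b, bmap (idm a) (idm b) = idm (bobj a b);
  bmapM : forall a a' a'' b b' b'' (f' : a' ~> a'') (f : a ~> a')
      (g' : b' ~> b'') (g : b ~> b'),
    bmap (f' ∘ f) (g' ∘ g) = bmap f' g' ∘ bmap f g }.

Arguments bmap {A B C} T {a a' b b'} f g : rename.

(* Monoidal and module categories are not assumed strict: the suppressed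
   associators and unitors are the fields *assoc and *unit, directed
   (x ⊗ y) ⊗ z ~> x ⊗ (y ⊗ z), 1 ⊗ x ~> x, x ⊗ 1 ~> x, and they are inserted
   wherever a coherence law needs them. *)
Record monoidal_category := MonoidalCategory {
  mcat :> category;
  tensor : bifunctor mcat mcat mcat;
  munit : mcat;
  massoc : forall x y z : mcat,
    tensor (tensor x y) z ~> tensor x (tensor y z);
  mlunit : forall x : mcat, tensor munit x ~> x;
  mrunit : forall x : mcat, tensor x munit ~> x;
  massoc_iso : forall x y z, is_iso (massoc x y z);
  mlunit_iso : forall x, is_iso (mlunit x);
  mrunit_iso : forall x, is_iso (mrunit x);
  massocN : forall x x' y y' z z' (f : x ~> x') (g : y ~> y') (h : z ~> z'),
    massoc x' y' z' ∘ bmap tensor (bmap tensor f g) h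
    = bmap tensor f (bmap tensor g h) ∘ massoc x y z;
  mlunitN : forall x x' (f : x ~> x'),
    mlunit x' ∘ bmap tensor (idm munit) f = f ∘ mlunit x;
  mrunitN : forall x x' (f : x ~> x'),
    mrunit x' ∘ bmap tensor f (idm munit) = f ∘ mrunit x;
  mpentagon : forall w x y z,
    massoc w x (tensor y z) ∘ massoc (tensor w x) y z
    = bmap tensor (idm w) (massoc x y z) ∘ massoc w (tensor x y) z
        ∘ bmap tensor (massoc w x y) (idm z);
  mtriangle : forall x y,
    bmap tensor (idm x) (mlunit y) ∘ massoc x munit y
    = bmap tensor (mrunit x) (idm y) }.

Arguments munit : clear implicits.
Notation "x ⊗ y" := (bobj (tensor _) x y) : cat_scope.
Notation "f ⊗₁ g" := (bmap (tensor _) f g) : cat_scope.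

Record right_module (C : monoidal_category) := RightModule {
  rmcat :> category;
  ract : bifunctor rmcat C rmcat;
  rassoc : forall (m : rmcat) (x y : C),
    ract (ract m x) y ~> ract m (x ⊗ y);
  runit : forall m : rmcat, ract m (munit C) ~> m;
  rassoc_iso : forall m x y, is_iso (rassoc m x y);
  runit_iso : forall m, is_iso (runit m);
  rassocN : forall m m' x x' y y' (f : m ~> m') (g : x ~> x') (h : y ~> y'),
    rassoc m' x' y' ∘ bmap ract (bmap ract f g) h
    = bmap ract f (g ⊗₁ h) ∘ rassoc m x y;
  runitN : forall m m' (f : m ~> m'),
    runit m' ∘ bmap ract f (idm (munit C)) = f ∘ runit m;
  rpentagon : forall m x y z,
    rassoc m x (y ⊗ z) ∘ rassoc (ract m x) y z
    = bmap ract (idm m) (massoc x y z) ∘ rassoc m (x ⊗ y) z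
        ∘ bmap ract (rassoc m x y) (idm z);
  rtriangle : forall m x,
    bmap ract (idm m) (mlunit x) ∘ rassoc m (munit C) x
    = bmap ract (runit m) (idm x) }.

Notation "m ◁ x" := (bobj (ract _) m x) : cat_scope.
Notation "f ◁₁ g" := (bmap (ract _) f g) : cat_scope.

Record left_module (C : monoidal_category) := LeftModule {
  lmcat :> category;
  lact : bifunctor C lmcat lmcat;
  lassoc : forall (x y : C) (m : lmcat),
    lact (x ⊗ y) m ~> lact x (lact y m);
  lunit : forall m : lmcat, lact (munit C) m ~> m;
  lassoc_iso : forall x y m, is_iso (lassoc x y m);
  lunit_iso : forall m, is_iso (lunit m);
  lassocN : forall x x' y y' m m' (g : x ~> x') (h : y ~> y') (f : m ~> m'),
    lassoc x' y' m' ∘ bmap lact (g ⊗₁ h) f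
    = bmap lact g (bmap lact h f) ∘ lassoc x y m;
  lunitN : forall m m' (f : m ~> m'),
    lunit m' ∘ bmap lact (idm (munit C)) f = f ∘ lunit m;
  lpentagon : forall x y z m,
    lassoc x y (lact z m) ∘ lassoc (x ⊗ y) z m
    = bmap lact (idm x) (lassoc y z m) ∘ lassoc x (y ⊗ z) m
        ∘ bmap lact (massoc x y z) (idm m);
  ltriangle : forall x m,
    bmap lact (idm x) (lunit m) ∘ lassoc x (munit C) m
    = bmap lact (mrunit x) (idm m) }.

Notation "x ▷ m" := (bobj (lact _) x m) : cat_scope.
Notation "f ▷₁ g" := (bmap (lact _) f g) : cat_scope.

Record oplax_monoidal_functor (C D : monoidal_category) := OplaxMonoidal {
  omf :> functor C D;
  om2 : forall x y : C, omf (x ⊗ y) ~> omf x ⊗ omf y;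
  om0 : omf (munit C) ~> munit D;
  om2N : forall x x' y y' (f : x ~> x') (g : y ~> y'),
    om2 x' y' ∘ fmap omf (f ⊗₁ g) = (fmap omf f ⊗₁ fmap omf g) ∘ om2 x y;
  om2_assoc : forall x y z,
    massoc (omf x) (omf y) (omf z)
      ∘ (om2 x y ⊗₁ idm (omf z)) ∘ om2 (x ⊗ y) z
    = (idm (omf x) ⊗₁ om2 y z) ∘ om2 x (y ⊗ z) ∘ fmap omf (massoc x y z);
  om_lunit : forall x,
    mlunit (omf x) ∘ (om0 ⊗₁ idm (omf x)) ∘ om2 (munit C) x
    = fmap omf (mlunit x);
  om_runit : forall x,
    mrunit (omf x) ∘ (idm (omf x) ⊗₁ om0) ∘ om2 x (munit C)
    = fmap omf (mrunit x) }.

Section IdentityOplax.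
Variable C : monoidal_category.

Fact idOM_N (x x' y y' : C) (f : x ~> x') (g : y ~> y') :
  idm (x' ⊗ y') ∘ fmap (idF C) (f ⊗₁ g)
  = (fmap (idF C) f ⊗₁ fmap (idF C) g) ∘ idm (x ⊗ y).
Proof. by rewrite /= comp1m compm1. Qed.

Fact idOM_assoc (x y z : C) :
  massoc x y z ∘ (idm (x ⊗ y) ⊗₁ idm z) ∘ idm ((x ⊗ y) ⊗ z)
  = (idm x ⊗₁ idm (y ⊗ z)) ∘ idm (x ⊗ (y ⊗ z)) ∘ fmap (idF C) (massoc x y z).
Proof. by rewrite /= !bmap1 !compm1 comp1m. Qed.

Fact idOM_lunit (x : C) :
  mlunit x ∘ (idm (munit C) ⊗₁ idm x) ∘ idm (munit C ⊗ x)
  = fmap (idF C) (mlunit x).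
Proof. by rewrite /= bmap1 !compm1. Qed.

Fact idOM_runit (x : C) :
  mrunit x ∘ (idm x ⊗₁ idm (munit C)) ∘ idm (x ⊗ munit C)
  = fmap (idF C) (mrunit x).
Proof. by rewrite /= bmap1 !compm1. Qed.

Definition idOM : oplax_monoidal_functor C C :=
  @OplaxMonoidal C C (idF C) (fun x y => idm (x ⊗ y)) (idm (munit C))
    idOM_N idOM_assoc idOM_lunit idOM_runit.
End IdentityOplax.

Section CompositeOplax.
Variables C D E : monoidal_category.
Variables (G : oplax_monoidal_functor D E) (F : oplax_monoidal_functor C D).

Definition compOM2 (x y : C) : compF G F (x ⊗ y) ~> compF G F x ⊗ compF G F y :=
  om2 G (F x) (F y) ∘ fmap G (om2 F x y).

Definition compOM0 : compF G F (munit C) ~> munit E := om0 G ∘ fmap G (om0 F).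

Fact compOM_N (x x' y y' : C) (f : x ~> x') (g : y ~> y') :
  compOM2 x' y' ∘ fmap (compF G F) (f ⊗₁ g)
  = (fmap (compF G F) f ⊗₁ fmap (compF G F) g) ∘ compOM2 x y.
Proof.
by rewrite /compOM2 /= -compA -fmapM om2N fmapM !compA om2N.
Qed.

Fact compOM_assoc (x y z : C) :
  massoc (compF G F x) (compF G F y) (compF G F z)
    ∘ (compOM2 x y ⊗₁ idm (compF G F z)) ∘ compOM2 (x ⊗ y) z
  = (idm (compF G F x) ⊗₁ compOM2 y z) ∘ compOM2 x (y ⊗ z)
      ∘ fmap (compF G F) (massoc x y z).
Proof.
rewrite /compOM2 /=.
have eL : (om2 G (F x) (F y) ∘ fmap G (om2 F x y)) ⊗₁ idm (G (F z))
  = (om2 G (F x) (F y) ⊗₁ idm (G (F z)))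
      ∘ (fmap G (om2 F x y) ⊗₁ fmap G (idm (F z))).
  by rewrite -bmapM fmap1 compm1.
have eR : idm (G (F x)) ⊗₁ (om2 G (F y) (F z) ∘ fmap G (om2 F y z))
  = (idm (G (F x)) ⊗₁ om2 G (F y) (F z))
      ∘ (fmap G (idm (F x)) ⊗₁ fmap G (om2 F y z)).
  by rewrite -bmapM fmap1 comp1m.
rewrite {}eL {}eR !compA.
rewrite -(compA _ _ (om2 G (F (x ⊗ y)) (F z))) -om2N !compA om2_assoc.
rewrite -(compA _ _ (om2 G (F x) (F (y ⊗ z)))) -om2N.
by rewrite -!compA -!fmapM !compA om2_assoc.
Qed.

Fact compOM_lunit (x : C) :
  mlunit (compF G F x) ∘ (compOM0 ⊗₁ idm (compF G F x)) ∘ compOM2 (munit C) x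
  = fmap (compF G F) (mlunit x).
Proof.
rewrite /compOM2 /compOM0 /=.
have -> : (om0 G ∘ fmap G (om0 F)) ⊗₁ idm (G (F x))
  = (om0 G ⊗₁ idm (G (F x))) ∘ (fmap G (om0 F) ⊗₁ fmap G (idm (F x))).
  by rewrite -bmapM fmap1 compm1.
rewrite !compA -(compA _ _ (om2 G (F (munit C)) (F x))) -om2N !compA om_lunit.
by rewrite -!fmapM om_lunit.
Qed.

Fact compOM_runit (x : C) :
  mrunit (compF G F x) ∘ (idm (compF G F x) ⊗₁ compOM0) ∘ compOM2 x (munit C)
  = fmap (compF G F) (mrunit x).
Proof.
rewrite /compOM2 /compOM0 /=.
have -> : idm (G (F x)) ⊗₁ (om0 G ∘ fmap G (om0 F))
  = (idm (G (F x)) ⊗₁ om0 G) ∘ (fmap G (idm (F x)) ⊗₁ fmap G (om0 F)).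
  by rewrite -bmapM fmap1 compm1.
rewrite !compA -(compA _ _ (om2 G (F x) (F (munit C)))) -om2N !compA om_runit.
by rewrite -!fmapM om_runit.
Qed.

Definition compOM : oplax_monoidal_functor C E :=
  OplaxMonoidal compOM_N compOM_assoc compOM_lunit compOM_runit.
End CompositeOplax.

Definition oplax_monoidal_transformation (C D : monoidal_category)
    (F G : oplax_monoidal_functor C D) (t : nat_trans F G) : Prop :=
  (forall x y : C, om2 G x y ∘ t (x ⊗ y) = (t x ⊗₁ t y) ∘ om2 F x y)
  /\ om0 G ∘ t (munit C) = om0 F.

Record oplax_monoidal_adjunction (C D : monoidal_category)
    (F : oplax_monoidal_functor C D) (U : oplax_monoidal_functor D C) :=
  OplaxMonoidalAdjunction {
  oma :> adjunction F U;
  oma_unit : @oplax_monoidal_transformation C C (idOM C) (compOM U F)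
    (adj_unit oma);
  oma_counit : @oplax_monoidal_transformation D D (compOM F U) (idOM D)
    (adj_counit oma) }.

Record comodule_structure (C D : monoidal_category)
    (F : oplax_monoidal_functor C D) (M : right_module C) (N : right_module D)
    (G : functor M N) := ComoduleStructure {
  coact :> forall (m : M) (x : C), G (m ◁ x) ~> G m ◁ F x;
  coactN : forall m m' x x' (f : m ~> m') (g : x ~> x'),
    coact m' x' ∘ fmap G (f ◁₁ g) = (fmap G f ◁₁ fmap F g) ∘ coact m x;
  coact_assoc : forall m x y,
    rassoc (G m) (F x) (F y)
      ∘ (coact m x ◁₁ idm (F y)) ∘ coact (m ◁ x) y
    = (idm (G m) ◁₁ om2 F x y) ∘ coact m (x ⊗ y) ∘ fmap G (rassoc m x y);
  coact_unit : forall m,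
    runit (G m) ∘ (idm (G m) ◁₁ om0 F) ∘ coact m (munit C)
    = fmap G (runit m) }.

Record strong_comodule_structure (C D : monoidal_category)
    (F : oplax_monoidal_functor C D) (M : right_module C) (N : right_module D)
    (G : functor M N) := StrongComoduleStructure {
  scs :> comodule_structure F G;
  scs_strong : forall m x, is_iso (scs m x) }.

Record comodule_adjunction_lift (C D : monoidal_category)
    (F : oplax_monoidal_functor C D) (U : oplax_monoidal_functor D C)
    (A : oplax_monoidal_adjunction F U)
    (M : right_module C) (N : right_module D)
    (G : functor M N) (V : functor N M) (B : adjunction G V) :=
  ComoduleAdjunctionLift {
  cal_left : comodule_structure F G;
  cal_right : comodule_structure U V;
  cal_unit : forall (m : M) (x : C),
    cal_right (G m) (F x) ∘ fmap V (cal_left m x) ∘ adj_unit B (m ◁ x)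
    = adj_unit B m ◁₁ adj_unit A x;
  cal_counit : forall (n : N) (y : D),
    (adj_counit B n ◁₁ adj_counit A y) ∘ cal_left (V n) (U y) ∘ fmap G (cal_right n y)
    = adj_counit B (n ◁ y) }.

Record oplax_module_structure (C : monoidal_category) (M N : left_module C)
    (F : functor M N) := OplaxModuleStructure {
  opl :> forall (x : C) (m : M), F (x ▷ m) ~> x ▷ F m;
  oplN : forall x x' m m' (g : x ~> x') (f : m ~> m'),
    opl x' m' ∘ fmap F (g ▷₁ f) = (g ▷₁ fmap F f) ∘ opl x m;
  opl_assoc : forall x y m,
    lassoc x y (F m) ∘ opl (x ⊗ y) m
    = (idm x ▷₁ opl y m) ∘ opl x (y ▷ m) ∘ fmap F (lassoc x y m);
  opl_unit : forall m, lunit (F m) ∘ opl (munit C) m = fmap F (lunit m) }.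

Record lax_module_structure (C : monoidal_category) (M N : left_module C)
    (F : functor M N) := LaxModuleStructure {
  lax :> forall (x : C) (m : M), x ▷ F m ~> F (x ▷ m);
  laxN : forall x x' m m' (g : x ~> x') (f : m ~> m'),
    lax x' m' ∘ (g ▷₁ fmap F f) = fmap F (g ▷₁ f) ∘ lax x m;
  lax_assoc : forall x y m,
    fmap F (lassoc x y m) ∘ lax (x ⊗ y) m
    = lax x (y ▷ m) ∘ (idm x ▷₁ lax y m) ∘ lassoc x y (F m);
  lax_unit : forall m, fmap F (lunit m) ∘ lax (munit C) m = lunit (F m) }.

(* Main.v *)
Require Import Defs.
From mathcomp Require Import ssreflect ssrfun.
From Stdlib Require Import FunctionalExtensionality ProofIrrelevance
  IndefiniteDescription.
(* [comp] and [compA] are the categorical ones, not those of [ssrfun]. *)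
Import Defs.
Local Open Scope cat_scope.

Set Implicit Arguments.
Unset Strict Implicit.
Unset Printing Implicit Defensive.

(** Both parts are instances of the calculus of mates. For an adjunction, a
    morphism out of a value of the left adjoint is the same as its adjunct, the
    transposed morphism into a value of the right adjoint; adjuncts are natural
    in both variables, so an equation between morphisms out of [G m] may be
    checked on adjuncts.

    Part (2): the oplax structure [a] and the lax structure [l] correspond when
    the adjunct of [a x m] is [l x (F m)] precomposed with [idm x ▷₁ η m], or
    equivalently when [l x n] is the adjunct of [a x (U n)] postcomposed with
    [idm x ▷₁ ε n]. The triangle identities say that these two conditions agree,
    and transposing the axioms for one side gives the axioms for the other.

    Part (1): the first axiom of a comodule adjunction reads
    [Va (G m) (F x) ∘ adjunct (Ga m x) = η m ◁₁ η x]. If both axioms hold, then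
    the adjunct of [(ε n ◁₁ ε y) ∘ Ga (V n) (U y)] is a two-sided inverse of
    [Va n y], so [V] is strong, and [Ga] is determined by [Va]. Conversely,
    when [Va] is invertible, the first axiom can be solved for [Ga], and the
    remaining requirements may be checked after transposing and composing with
    [Va]. For the coassociativity of [Ga] one more comparison map has to be
    cancelled on the left, namely [om2 U]; it is a split monomorphism, since the
    right adjoint of an oplax monoidal adjunction is strong monoidal. *)

(** * Adjuncts *)

Section Adjunct.
Variables (C D : category) (F : functor C D) (U : functor D C).
Variable A : adjunction F U.

(** These retype the unit and the counit, so that no composite functor appears
    in the types of source and target. *)
Definition unit (x : C) : x ~> U (F x) := adj_unit A x.
Definition counit (y : D) : F (U y) ~> y := adj_counit A y.

Lemma unitN (x x' : C) (f : x ~> x') : unit x' ∘ f = fmap U (fmap F f) ∘ unit x.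
Proof. exact: (ntcN (adj_unit A) f). Qed.

Lemma counitN (y y' : D) (g : y ~> y') :
  counit y' ∘ fmap F (fmap U g) = g ∘ counit y.
Proof. exact: (ntcN (adj_counit A) g). Qed.

Definition adjunct (x : C) (y : D) (h : F x ~> y) : x ~> U y :=
  fmap U h ∘ unit x.

Definition coadjunct (x : C) (y : D) (k : x ~> U y) : F x ~> y :=
  counit y ∘ fmap F k.

Lemma adjunctK x y : cancel (@adjunct x y) (@coadjunct x y).
Proof.
move=> h; rewrite /coadjunct /adjunct fmapM compA counitN -compA.
by rewrite (adj_triangleL A) compm1.
Qed.

Lemma coadjunctK x y : cancel (@coadjunct x y) (@adjunct x y).
Proof.
move=> k; rewrite /coadjunct /adjunct fmapM -compA -unitN compA.
by rewrite (adj_triangleR A) comp1m.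
Qed.

Lemma adjunct_inj x y : injective (@adjunct x y).
Proof. exact: can_inj (@adjunctK x y). Qed.

Lemma adjunct_compl x y y' (g : y ~> y') (h : F x ~> y) :
  adjunct (g ∘ h) = fmap U g ∘ adjunct h.
Proof. by rewrite /adjunct fmapM compA. Qed.

Lemma adjunct_compr x x' y (h : F x' ~> y) (f : x ~> x') :
  adjunct (h ∘ fmap F f) = adjunct h ∘ f.
Proof. by rewrite /adjunct fmapM -!compA unitN. Qed.

Lemma adjunct_fmap x x' (f : x ~> x') : adjunct (fmap F f) = unit x' ∘ f.
Proof. by rewrite unitN. Qed.

Lemma adjunct_counit y : adjunct (counit y) = idm (U y).
Proof. exact: adj_triangleR. Qed.

Lemma counit_unit x : counit (F x) ∘ fmap F (unit x) = idm (F x).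
Proof. exact: adj_triangleL. Qed.

Lemma fmap_counit_unit y : fmap U (counit y) ∘ unit (U y) = idm (U y).
Proof. exact: adj_triangleR. Qed.

Lemma counit_fmap_adjunct x y (h : F x ~> y) :
  counit y ∘ fmap F (adjunct h) = h.
Proof. exact: adjunctK. Qed.

End Adjunct.

Lemma bmap_idlM (A B C : category) (T : bifunctor A B C) a b b' b''
    (g' : b' ~> b'') (g : b ~> b') :
  bmap T (idm a) (g' ∘ g) = bmap T (idm a) g' ∘ bmap T (idm a) g.
Proof. by rewrite -bmapM comp1m. Qed.

(** * Extensionality of the structures *)

Lemma oplax_module_structure_ext (C : monoidal_category) (M N : left_module C)
    (F : functor M N) (a b : oplax_module_structure F) :
  (forall x m, a x m = b x m) -> a = b.
Proof.
case: a b => [a aN aA aU] [b bN bA bU] /= eab.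
have e : a = b.
  by do 2![apply: functional_extensionality_dep => ?]; apply: eab.
by case: b / e bN bA bU {eab} => *; congr OplaxModuleStructure;
  apply: proof_irrelevance.
Qed.

Lemma lax_module_structure_ext (C : monoidal_category) (M N : left_module C)
    (F : functor M N) (a b : lax_module_structure F) :
  (forall x m, a x m = b x m) -> a = b.
Proof.
case: a b => [a aN aA aU] [b bN bA bU] /= eab.
have e : a = b.
  by do 2![apply: functional_extensionality_dep => ?]; apply: eab.
by case: b / e bN bA bU {eab} => *; congr LaxModuleStructure;
  apply: proof_irrelevance.
Qed.

Lemma comodule_structure_ext (C D : monoidal_category)
    (F : oplax_monoidal_functor C D) (M : right_module C) (N : right_module D)
    (G : functor M N) (a b : comodule_structure F G) :
  (forall m x, a m x = b m x) -> a = b.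
Proof.
case: a b => [a aN aA aU] [b bN bA bU] /= eab.
have e : a = b.
  by do 2![apply: functional_extensionality_dep => ?]; apply: eab.
by case: b / e bN bA bU {eab} => *; congr ComoduleStructure;
  apply: proof_irrelevance.
Qed.

Lemma strong_comodule_structure_ext (C D : monoidal_category)
    (F : oplax_monoidal_functor C D) (M : right_module C) (N : right_module D)
    (G : functor M N) (a b : strong_comodule_structure F G) :
  (forall m x, a m x = b m x) -> a = b.
Proof.
case: a b => [a aS] [b bS] /= /comodule_structure_ext e.
by case: b / e bS => bS; congr StrongComoduleStructure; apply: proof_irrelevance.
Qed.

Lemma comodule_adjunction_lift_ext (C D : monoidal_category)
    (F : oplax_monoidal_functor C D) (U : oplax_monoidal_functor D C)
    (A : oplax_monoidal_adjunction F U) (M : right_module C) (N : right_module D)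
    (G : functor M N) (V : functor N M) (B : adjunction G V)
    (K L : comodule_adjunction_lift A B) :
  (forall m x, cal_left K m x = cal_left L m x) ->
  (forall n y, cal_right K n y = cal_right L n y) -> K = L.
Proof.
case: K L => [a b ? ?] [a' b' u c] /=.
move=> /comodule_structure_ext ea /comodule_structure_ext eb.
case: a' / ea u c => u c; case: b' / eb u c => u c.
by congr ComoduleAdjunctionLift; apply: proof_irrelevance.
Qed.

(** * Oplax module structures on a left adjoint *)

Section ModuleMates.
Variables (C : monoidal_category) (M N : left_module C).
Variables (F : functor M N) (U : functor N M) (A : adjunction F U).

Section LaxOfOplax.
Variable a : oplax_module_structure F.

(** The axioms for this mate are the transposes of those of [a] at objects
    [U n], with the counit moved past [a] by naturality. *)
Definition lax_mate (x : C) (n : N) : x ▷ U n ~> U (x ▷ n) :=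
  adjunct A ((idm x ▷₁ counit A n) ∘ a x (U n)).

Lemma lax_mateN x x' n n' (g : x ~> x') (f : n ~> n') :
  lax_mate x' n' ∘ (g ▷₁ fmap U f) = fmap U (g ▷₁ f) ∘ lax_mate x n.
Proof.
rewrite /lax_mate -adjunct_compr -adjunct_compl; congr adjunct.
rewrite -compA oplN !compA; congr comp.
by rewrite -!bmapM comp1m compm1 counitN.
Qed.

Lemma lax_mate_assoc x y n :
  fmap U (lassoc x y n) ∘ lax_mate (x ⊗ y) n
  = lax_mate x (y ▷ n) ∘ (idm x ▷₁ lax_mate y n) ∘ lassoc x y (U n).
Proof.
rewrite /lax_mate -!adjunct_compr -adjunct_compl; congr adjunct.
rewrite -(compA _ (a x _)) oplN !compA -bmap_idlM counit_fmap_adjunct.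
rewrite -(bmap1 (tensor C)) lassocN -(compA _ (lassoc _ _ _)) opl_assoc !compA.
by rewrite -bmap_idlM.
Qed.

Lemma lax_mate_unit n : fmap U (lunit n) ∘ lax_mate (munit C) n = lunit (U n).
Proof.
rewrite /lax_mate -adjunct_compl compA lunitN -compA opl_unit.
by rewrite adjunct_compr adjunct_counit comp1m.
Qed.

Definition lax_of_oplax : lax_module_structure U :=
  LaxModuleStructure lax_mateN lax_mate_assoc lax_mate_unit.

End LaxOfOplax.

Section OplaxOfLax.
Variable l : lax_module_structure U.

Definition oplax_mate (x : C) (m : M) : F (x ▷ m) ~> x ▷ F m :=
  coadjunct A (l x (F m) ∘ (idm x ▷₁ unit A m)).

(** Characterises the mate by its adjunct, so that its axioms follow from those
    of [l] at objects [F m] and the naturality of [l] in the unit. *)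
Lemma adjunct_oplax_mate x m :
  adjunct A (oplax_mate x m) = l x (F m) ∘ (idm x ▷₁ unit A m).
Proof. exact: coadjunctK. Qed.

Lemma oplax_mateN x x' m m' (g : x ~> x') (f : m ~> m') :
  oplax_mate x' m' ∘ fmap F (g ▷₁ f) = (g ▷₁ fmap F f) ∘ oplax_mate x m.
Proof.
apply: (adjunct_inj (A := A)).
rewrite adjunct_compr adjunct_compl !adjunct_oplax_mate.
rewrite compA -laxN -!compA; congr comp.
by rewrite -!bmapM comp1m compm1 unitN.
Qed.

Lemma oplax_mate_assoc x y m :
  lassoc x y (F m) ∘ oplax_mate (x ⊗ y) m
  = (idm x ▷₁ oplax_mate y m) ∘ oplax_mate x (y ▷ m) ∘ fmap F (lassoc x y m).
Proof.
apply: (adjunct_inj (A := A)).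
rewrite adjunct_compr adjunct_compl (adjunct_compl A (idm x ▷₁ _)).
rewrite !adjunct_oplax_mate !compA -laxN -(compA (l x _)) -bmap_idlM.
rewrite -/(adjunct A _) adjunct_oplax_mate bmap_idlM compA lax_assoc -!compA.
by rewrite -lassocN bmap1.
Qed.

Lemma oplax_mate_unit m :
  lunit (F m) ∘ oplax_mate (munit C) m = fmap F (lunit m).
Proof.
apply: (adjunct_inj (A := A)).
rewrite adjunct_compl adjunct_oplax_mate adjunct_fmap.
by rewrite compA lax_unit lunitN.
Qed.

Definition oplax_of_lax : oplax_module_structure F :=
  OplaxModuleStructure oplax_mateN oplax_mate_assoc oplax_mate_unit.

End OplaxOfLax.

Lemma lax_of_oplaxK : cancel lax_of_oplax oplax_of_lax.
Proof.
move=> a; apply: oplax_module_structure_ext => x m.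
apply: (adjunct_inj (A := A)).
rewrite adjunct_oplax_mate /= /lax_mate -adjunct_compr.
by rewrite -compA oplN compA -bmap_idlM counit_unit bmap1 comp1m.
Qed.

Lemma oplax_of_laxK : cancel oplax_of_lax lax_of_oplax.
Proof.
move=> l; apply: lax_module_structure_ext => x n.
rewrite /= /lax_mate adjunct_compl adjunct_oplax_mate compA -laxN -compA.
by rewrite -bmap_idlM fmap_counit_unit bmap1 compm1.
Qed.

End ModuleMates.

(** * Oplax monoidal adjunctions *)

Section OplaxMonoidalUnits.
Variables (C D : monoidal_category).
Variables (F : oplax_monoidal_functor C D) (U : oplax_monoidal_functor D C).
Variable A : oplax_monoidal_adjunction F U.

Lemma unit_tensor (x y : C) :
  om2 U (F x) (F y) ∘ fmap U (om2 F x y) ∘ unit A (x ⊗ y) = unit A x ⊗₁ unit A y.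
Proof. by have [/(_ x y) /= + _] := oma_unit A; rewrite compm1. Qed.

Lemma unit_munit : om0 U ∘ fmap U (om0 F) ∘ unit A (munit C) = idm (munit C).
Proof. by have [_ /=] := oma_unit A. Qed.

Lemma counit_tensor (x y : D) :
  (counit A x ⊗₁ counit A y) ∘ (om2 F (U x) (U y) ∘ fmap F (om2 U x y))
  = counit A (x ⊗ y).
Proof. by have [/(_ x y) /= + _] := oma_counit A; rewrite comp1m. Qed.

(** The oplax monoidal half of doctrinal adjunction: the mate of [om2 F]
    retracts [om2 U], because the counit of [A] is monoidal. This is what allows
    [om2 U] to be cancelled on the left. *)
Lemma om2_retraction (x y : D) :
  adjunct A ((counit A x ⊗₁ counit A y) ∘ om2 F (U x) (U y)) ∘ om2 U x y
  = idm (U (x ⊗ y)).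
Proof. by rewrite -adjunct_compr -compA counit_tensor adjunct_counit. Qed.

End OplaxMonoidalUnits.

(** * Comodule adjunctions *)

Section ComoduleAdjunctions.
Variables (C D : monoidal_category) (M : right_module C) (N : right_module D).
Variables (F : oplax_monoidal_functor C D) (U : oplax_monoidal_functor D C).
Variable A : oplax_monoidal_adjunction F U.
Variables (G : functor M N) (V : functor N M) (B : adjunction G V).

Lemma cal_unit_adjunct (L : comodule_adjunction_lift A B) (m : M) (x : C) :
  cal_right L (G m) (F x) ∘ adjunct B (cal_left L m x) = unit B m ◁₁ unit A x.
Proof. by rewrite compA; apply: cal_unit. Qed.

(** Naturality of the coaction of [V] at the counits turns the unit axiom, which
    lives on the image of [G] and [F], into a statement about all [n] and [y]. *)
Lemma coaction_adjunct (Va : comodule_structure U V)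
    (Ga : forall (m : M) (x : C), G (m ◁ x) ~> G m ◁ F x) (n : N) (y : D) :
  Va (G (V n)) (F (U y)) ∘ adjunct B (Ga (V n) (U y))
    = unit B (V n) ◁₁ unit A (U y) ->
  Va n y ∘ adjunct B ((counit B n ◁₁ counit A y) ∘ Ga (V n) (U y))
  = idm (V n ◁ U y).
Proof.
move=> e; rewrite adjunct_compl compA coactN -compA e -bmapM.
by rewrite !fmap_counit_unit bmap1.
Qed.

Lemma cal_right_strong (L : comodule_adjunction_lift A B) (n : N) (y : D) :
  is_iso (cal_right L n y).
Proof.
exists (adjunct B ((counit B n ◁₁ counit A y) ∘ cal_left L (V n) (U y))).
split; last by apply: coaction_adjunct; apply: cal_unit_adjunct.
by rewrite -adjunct_compr (cal_counit L) adjunct_counit.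
Qed.

Definition strong_of_lift (L : comodule_adjunction_lift A B) :
    strong_comodule_structure U V :=
  StrongComoduleStructure (cal_right_strong L).

Section LiftOfStrong.
Variable Va : strong_comodule_structure U V.

(** Being invertible only asserts that an inverse exists, whereas the coaction
    of [G] is data built from it; the choice is harmless, inverses being
    unique. *)
Definition coaction_inv (n : N) (y : D) : V n ◁ U y ~> V (n ◁ y) :=
  sval (constructive_indefinite_description _ (scs_strong Va n y)).

Lemma coactionK n y : coaction_inv n y ∘ Va n y = idm (V (n ◁ y)).
Proof.
by rewrite /coaction_inv; case: constructive_indefinite_description => ? [].
Qed.

Lemma coactionVK n y : Va n y ∘ coaction_inv n y = idm (V n ◁ U y).
Proof.
by rewrite /coaction_inv; case: constructive_indefinite_description => ? [].
Qed.

Lemma coaction_cancel (m : M) n y (f g : m ~> V (n ◁ y)) :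
  Va n y ∘ f = Va n y ∘ g -> f = g.
Proof.
by move=> e; rewrite -(comp1m f) -coactionK -compA e compA coactionK comp1m.
Qed.

(** Solves the unit axiom of a comodule adjunction for the coaction of [G]. *)
Definition left_coaction (m : M) (x : C) : G (m ◁ x) ~> G m ◁ F x :=
  coadjunct B (coaction_inv (G m) (F x) ∘ (unit B m ◁₁ unit A x)).

(** The unit axiom of a comodule adjunction; since [Va] is invertible and
    transposition is injective, it determines the coaction of [G]. *)
Lemma left_coactionE m x :
  Va (G m) (F x) ∘ adjunct B (left_coaction m x) = unit B m ◁₁ unit A x.
Proof. by rewrite coadjunctK compA coactionVK comp1m. Qed.

Lemma left_coactionN m m' x x' (f : m ~> m') (g : x ~> x') :
  left_coaction m' x' ∘ fmap G (f ◁₁ g)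
  = (fmap G f ◁₁ fmap F g) ∘ left_coaction m x.
Proof.
apply: (adjunct_inj (A := B)); apply: coaction_cancel.
rewrite adjunct_compr compA left_coactionE adjunct_compl compA coactN -compA.
by rewrite left_coactionE -!bmapM !unitN.
Qed.

Lemma left_coaction_assoc m x y :
  rassoc (G m) (F x) (F y)
    ∘ (left_coaction m x ◁₁ idm (F y)) ∘ left_coaction (m ◁ x) y
  = (idm (G m) ◁₁ om2 F x y) ∘ left_coaction m (x ⊗ y)
      ∘ fmap G (rassoc m x y).
Proof.
apply: (adjunct_inj (A := B)); apply: coaction_cancel.
(* Postcomposing with the split monomorphism built from [om2 U] brings both
   sides to a form where the comodule axioms of [V] apply. *)
suff e : (idm (V (G m)) ◁₁ om2 U (F x) (F y)) ∘
      (Va (G m) (F x ⊗ F y) ∘ adjunct B (rassoc (G m) (F x) (F y)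
        ∘ (left_coaction m x ◁₁ idm (F y)) ∘ left_coaction (m ◁ x) y))
    = (idm (V (G m)) ◁₁ om2 U (F x) (F y)) ∘
      (Va (G m) (F x ⊗ F y) ∘ adjunct B ((idm (G m) ◁₁ om2 F x y)
        ∘ left_coaction m (x ⊗ y) ∘ fmap G (rassoc m x y))).
  have := f_equal (comp (idm (V (G m)) ◁₁ adjunct A
    ((counit A (F x) ⊗₁ counit A (F y)) ∘ om2 F (U (F x)) (U (F y))))) e.
  by rewrite !compA -!bmap_idlM om2_retraction bmap1 !comp1m.
(* The left side reaches the middle term by coassociativity of [V] and two uses
   of the unit axiom, the right side by one use of it, the unit of [A] being
   monoidal. *)
transitivity ((unit B m ◁₁ (unit A x ⊗₁ unit A y)) ∘ rassoc m x y).
  rewrite adjunct_compl fmapM.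
  have := left_coactionE (m ◁ x) y.
  move: (adjunct B (left_coaction (m ◁ x) y)) => h hE.
  rewrite !compA -coact_assoc -(compA _ _ (fmap V (_ ◁₁ _))) coactN.
  rewrite -!compA hE -bmapM -/(adjunct B _) fmap1 comp1m.
  by rewrite -bmapM left_coactionE comp1m rassocN.
rewrite adjunct_compr adjunct_compl.
have := left_coactionE m (x ⊗ y).
move: (adjunct B (left_coaction m (x ⊗ y))) => h hE.
rewrite !compA -(compA _ (Va _ _)) coactN -!compA (compA (Va _ _)) hE.
by rewrite fmap1 !compA -!bmapM !comp1m unit_tensor.
Qed.

Lemma left_coaction_unit m :
  runit (G m) ∘ (idm (G m) ◁₁ om0 F) ∘ left_coaction m (munit C)
  = fmap G (runit m).
Proof.
apply: (adjunct_inj (A := B)).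
rewrite adjunct_fmap adjunct_compl fmapM.
have := left_coactionE m (munit C).
move: (adjunct B (left_coaction m (munit C))) => h hE.
rewrite -(coact_unit Va) -!compA (compA (Va _ _)) coactN -compA hE.
by rewrite fmap1 -!bmapM !comp1m compA unit_munit runitN.
Qed.

Definition left_comodule : comodule_structure F G :=
  ComoduleStructure left_coactionN left_coaction_assoc left_coaction_unit.

Lemma left_comodule_unit m x :
  Va (G m) (F x) ∘ fmap V (left_comodule m x) ∘ adj_unit B (m ◁ x)
  = adj_unit B m ◁₁ adj_unit A x.
Proof. by have := left_coactionE m x; rewrite compA. Qed.

Lemma left_comodule_counit n y :
  (adj_counit B n ◁₁ adj_counit A y) ∘ left_comodule (V n) (U y) ∘ fmap G (Va n y)
  = adj_counit B (n ◁ y).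
Proof.
apply: (adjunct_inj (A := B)).
rewrite adjunct_compr adjunct_counit.
apply: coaction_cancel; rewrite compA coaction_adjunct ?comp1m ?compm1 //.
exact: left_coactionE.
Qed.

Definition lift_of_strong : comodule_adjunction_lift A B :=
  ComoduleAdjunctionLift left_comodule_unit left_comodule_counit.

End LiftOfStrong.

Lemma strong_of_liftK : cancel strong_of_lift lift_of_strong.
Proof.
move=> L; apply: comodule_adjunction_lift_ext => // m x.
apply: (adjunct_inj (A := B)); apply: (@coaction_cancel (strong_of_lift L)).
by rewrite left_coactionE -(cal_unit_adjunct L).
Qed.

Lemma lift_of_strongK : cancel lift_of_strong strong_of_lift.
Proof. by move=> Va; apply: strong_comodule_structure_ext. Qed.

End ComoduleAdjunctions.

Theorem theorem5p28 :
  (forall (C D : monoidal_category) (M : right_module C) (N : right_module D)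
      (F : oplax_monoidal_functor C D) (U : oplax_monoidal_functor D C)
      (A : oplax_monoidal_adjunction F U)
      (G : functor M N) (V : functor N M) (B : adjunction G V),
    exists phi : comodule_adjunction_lift A B -> strong_comodule_structure U V,
      bijective phi
      /\ (forall (L : comodule_adjunction_lift A B) (n : N) (y : D),
            phi L n y = cal_right L n y))
  /\
  (forall (C : monoidal_category) (M N : left_module C)
      (F : functor M N) (U : functor N M) (A : adjunction F U),
    exists psi : oplax_module_structure F -> lax_module_structure U,
      bijective psi
      /\ (forall (a : oplax_module_structure F) (x : C) (n : N),
            psi a x n
            = fmap U ((idm x ▷₁ adj_counit A n) ∘ a x (U n)) ∘ adj_unit A (x ▷ U n))).
Proof.
split=> [C D M N F U A G V B | C M N F U A].
  exists (@strong_of_lift _ _ _ _ _ _ A _ _ B); split=> //.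
  exact: Bijective (@strong_of_liftK _ _ _ _ _ _ A _ _ B)
    (@lift_of_strongK _ _ _ _ _ _ A _ _ B).
exists (lax_of_oplax A); split=> //.
exact: Bijective (@lax_of_oplaxK _ _ _ _ _ A) (@oplax_of_laxK _ _ _ _ _ A).
Qed.
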